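(* Let $\mathcal{H}$ be a complex Hilbert space and let $A,D\in\mathcal{B}(\mathcal{H})$. Then $$\|A+D\|^2\le\|A\|^2+\|D\|^2+\|A\|\|D\|+\min\{w(A^*D),w(AD^* )\}\le(\|A\|+\|D\|)^2.$$
   Context: $\mathcal{B}(\mathcal{H})$ is the set of bounded linear operators on $\mathcal{H}$, $A^*$ is the adjoint of $A$, and $\|\cdot\|$ is the operator norm. The numerical radius is $w(A)=\sup\{|\langle Ax,x\rangle| : x\in\mathcal{H},\ \|x\|=1\}$. *)

(* Defs.v *)
From HB Require Import structures.
From mathcomp Require Import all_boot all_order all_algebra sesquilinear.
From mathcomp Require Import complex ring lra.
From mathcomp Require Import all_classical all_reals all_analysis.

Set Implicit Arguments.
Unset Strict Implicit.
Unset Printing Implicit Defensive.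

Import Order.TTheory GRing.Theory Num.Theory.
Import numFieldNormedType.Exports.

Local Open Scope classical_set_scope.
Local Open Scope ring_scope.
Local Open Scope complex_scope.

(* `inner` is linear in its first argument and conjugate-linear in its second;
   the norm of H, as that of any normed module over R[i], has values in R[i]. *)
HB.mixin Record CompleteNormedModule_isHilbert (R : realType) (H : Type)
    of CompleteNormedModule R[i] H := {
  inner : {dot H for @Num.conj R[i]} ;
  inner_normE : forall x : H, inner x x = `|x| ^+ 2
}.

#[short(type="hilbertType")]
HB.structure Definition Hilbert (R : realType) :=
  { H of CompleteNormedModule_isHilbert R H & CompleteNormedModule R[i] H }.

Definition bounded_operator (R : realType) (H : hilbertType R) (A : H -> H) :=
  exists M : R[i], forall x : H, `|A x| <= M * `|x|.

(* `|A x| : R[i] is a nonnegative real: complex.Re only casts it to R. *)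
Definition opnorm (R : realType) (H : hilbertType R) (A : H -> H) : R :=
  sup [set complex.Re `|A x| | x in [set x : H | `|x| <= 1]].

(* When H is the zero space there is no unit vector and the value is
   sup set0 = 0. *)
Definition numradius (R : realType) (H : hilbertType R) (A : H -> H) : R :=
  sup [set complex.Re `|inner (A x) x| | x in [set x : H | `|x| = 1]].

(* The vector z is unique since inner is definite; for a bounded linear A it
   exists (adjointP below), so the default value 0 of xget is never used. *)
Definition adjoint (R : realType) (H : hilbertType R) (A : H -> H) : H -> H :=
  fun y => xget 0 [set z : H | forall x, inner (A x) y = inner x z].

(* Riesz representation: the vector representing f is the limit of a minimizing
   sequence of x |-> `|x| ^+ 2 - 2 * Re (f x). *)
Module Riesz.
Section Riesz.
Variables (R : realType) (H : hilbertType R).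
Local Notation Re := complex.Re.
Local Notation N x := (Re `|x|).
Implicit Types x y h z : H.

Lemma discr (a b e : R) : 0 <= b ->
  (forall t, 0 <= e + 2 * t * a + t ^+ 2 * b) -> a ^+ 2 <= e * b.
Proof.
move=> b0 P; have e0 : 0 <= e by have := P 0; rewrite !(mulr0, mul0r, expr0n, addr0).
have [bE|bn] := eqVneq b 0.
  have [->|an] := eqVneq a 0; first by rewrite bE mulr0 expr0n.
  have := P (- (e + 1) / (2 * a)); rewrite bE mulr0 addr0.
  have -> : 2 * (- (e + 1) / (2 * a)) * a = - (e + 1) by field.
  lra.
have bp : 0 < b by rewrite lt_def bn.
have := P (- a / b).
have -> : e + 2 * (- a / b) * a + (- a / b) ^+ 2 * b = (e * b - a ^+ 2) / b by field.
by rewrite pmulr_lge0 ?invr_gt0// subr_ge0.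
Qed.

Lemma normcE x : `|x| = (N x)%:C :> R[i].
Proof. by rewrite RRe_real// normr_real. Qed.
Lemma N0 x : 0 <= N x.
Proof. by have := normr_ge0 x; rewrite normcE lecR. Qed.

Lemma innerxx x : inner x x = (N x ^+ 2)%:C.
Proof. by rewrite inner_normE {1}normcE rmorphXn. Qed.

Lemma innerC x y : inner x y = (inner y x)^*.
Proof. by rewrite (hermC inner) expr0 mul1r. Qed.

Lemma ReD (u v : R[i]) : Re (u + v) = Re u + Re v. Proof. by case: u; case: v. Qed.
Lemma ReZ (t : R) (u : R[i]) : Re (t%:C * u) = t * Re u.
Proof. by case: u => ? ?; rewrite /= mul0r subr0. Qed.
Lemma Reconj (u : R[i]) : Re (u^*) = Re u. Proof. by case: u. Qed.

Lemma NDZ x (t : R) h :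
  N (x + t%:C *: h) ^+ 2 = N x ^+ 2 + 2 * t * Re (inner h x) + t ^+ 2 * N h ^+ 2.
Proof.
have E : Re (inner (x + t%:C *: h) (x + t%:C *: h)) = N (x + t%:C *: h) ^+ 2
  by rewrite innerxx.
rewrite -E (linearDl inner) !(linearDr inner) /= !(linearZl_LR inner) !(linearZr_LR inner) /=.
rewrite !innerxx (innerC x h).
have -> : (t%:C)^*%R = t%:C :> R[i] by exact: conjc_real.
rewrite !ReD !ReZ Reconj /=.
ring.
Qed.

Lemma CSRe x y : Re (inner x y) ^+ 2 <= N x ^+ 2 * N y ^+ 2.
Proof.
rewrite mulrC; apply: discr; first exact: sqr_ge0.
by move=> t; rewrite -NDZ sqr_ge0.
Qed.

Lemma CSReN x y : `|Re (inner x y)| <= N x * N y.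
Proof.
rewrite -(@ler_pXn2r _ 2) ?nnegrE ?mulr_ge0 ?N0//.
by rewrite exprMn real_normK ?num_real// CSRe.
Qed.

Variables (f : H -> R[i]) (fD : forall x y, f (x + y) = f x + f y)
  (fZ : forall a x, f (a *: x) = a * f x)
  (M : R) (fM : forall x, `|Re (f x)| <= M * N x).

Let a h x := Re (inner h x) - Re (f h).
Let J x := N x ^+ 2 - 2 * Re (f x).

Lemma JDZ x (t : R) h : J (x + t%:C *: h) = J x + 2 * t * a h x + t ^+ 2 * N h ^+ 2.
Proof. rewrite /J /a NDZ fD fZ ReD ReZ; ring. Qed.

Lemma Jlb x : - M ^+ 2 <= J x.
Proof.
rewrite /J; have := fM x; rewrite ler_norml => /andP[_ h1].
have := sqr_ge0 (N x - M); nra.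
Qed.

Let m := inf (range J).
Lemma Jinf x : m <= J x.
Proof.
apply: ge_inf; last by exists x.
by exists (- M ^+ 2) => _ [y _ <-]; exact: Jlb.
Qed.

Lemma Jadh e : 0 < e -> exists x, J x < m + e.
Proof.
move=> e0; have [_ [x _ <-] ?] : exists2 r, range J r & r < m + e.
  apply: inf_adherent => //; split; first by exists (J 0); exists 0.
  by exists (- M ^+ 2) => _ [y _ <-]; exact: Jlb.
by exists x.
Qed.

Lemma Jpar x y : N (y - x) ^+ 2 <= 2 * (J x + J y - 2 * m).
Proof.
set d := y - x; pose c := x + (2^-1)%:C *: d.
have ex : x = c + (- 2^-1)%:C *: d.
  by rewrite /c -addrA -scalerDl -rmorphD subrr scale0r addr0.
have ey : y = c + (2^-1)%:C *: d.
  have half : 2^-1 + 2^-1 = 1 :> R by lra.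
  rewrite /c -addrA -scalerDl -rmorphD half.
  by rewrite scale1r /d addrC subrK.
have := JDZ c (- 2^-1) d; rewrite -ex => ->; have := JDZ c 2^-1 d; rewrite -ey => ->.
have := Jinf c; lra.
Qed.

Lemma riesz_ex : exists z, forall h, f h = inner h z.
Proof.
have /choice[u uP] : forall n : nat, exists x, J x < m + n.+1%:R^-1.
  by move=> n; apply: Jadh; rewrite invr_gt0.
have ucvg : cvg (u @ \oo).
  apply: cauchy_cvg; apply: cauchy_exP => e e0.
  have eE : e = (Re e)%:C by rewrite RRe_real// gtr0_real.
  have re0 : 0 < Re e by rewrite -ltcR -eE.
  have k0 : 0 < Re e ^+ 2 / 4 by rewrite divr_gt0 ?exprn_gt0.
  have := near_infty_natSinv_lt (PosNum k0); move=> [n _ nP].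
  exists (u n); exists n => // k /= nk.
  rewrite -ball_normE /ball_ /= eE distrC normcE ltcR.
  rewrite -(@ltr_pXn2r _ 2) ?nnegrE ?N0 ?(ltW re0)//.
  apply: le_lt_trans (Jpar _ _) _.
  have := uP n; have := uP k; have /= := nP _ nk; have /= := nP _ (leqnn n).
  move: (J (u n)) (J (u k)) (Re e ^+ 2) n.+1%:R^-1 k.+1%:R^-1 m => j1 j2 ee i1 i2 mm; lra.
have [z uz] : exists z, u @ \oo --> z by exists (lim (u @ \oo)).
exists z => h0.
have az h : a h z = 0.
  apply/eqP; rewrite -normr_le0; apply/ler_addgt0Pl => e e0; rewrite addr0.
  pose c := (N h + 1).
  have c0 : 0 < c by rewrite /c ltr_wpDl ?N0.
  have d0 : 0 < e / (2 * c) by rewrite divr_gt0 ?mulr_gt0.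
  have d20 : 0 < (e / (2 * c)) ^+ 2 by rewrite exprn_gt0.
  have [n1 _ n1P] := near_infty_natSinv_lt (PosNum d20).
  have dC : 0 < (e / (2 * c))%:C :> R[i] by rewrite ltcR.
  move/cvgrPdist_lt: uz => /(_ _ dC)[n2 _ n2P].
  pose n := maxn n1 n2.
  have /= := n1P n (leq_maxl _ _); have /= := n2P n (leq_maxr _ _).
  rewrite normcE ltcR => uz1 nd.
  have aun : a h (u n) ^+ 2 <= n.+1%:R^-1 * N h ^+ 2.
    apply: discr; first exact: sqr_ge0.
    by move=> t; have := Jinf (u n + t%:C *: h); rewrite JDZ; have := uP n; move: (J (u n)) n.+1%:R^-1 m (2 * t * a h (u n)) (t ^+ 2 * N h ^+ 2) => *; lra.
  have aun2 : `|a h (u n)| <= e / (2 * c) * N h.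
    rewrite -(@ler_pXn2r _ 2) ?nnegrE ?N0 ?(ltW d0)//; last by rewrite mulr_ge0 ?N0 ?(ltW d0).
    rewrite real_normK ?num_real// exprMn (le_trans aun)// ler_wpM2r ?sqr_ge0//.
    exact: ltW.
  have aD : a h z = a h (u n) + Re (inner h (z - u n)).
    by rewrite /a linearBr /=; case: (inner h z) (inner h (u n)) => [? ?] [? ?] /=; ring.
  rewrite aD (le_trans (ler_normD _ _))//.
  have := CSReN h (z - u n).
  have : N h * N (z - u n) <= N h * (e / (2 * c)) by rewrite ler_wpM2l ?N0 ?ltW.
  have : e / (2 * c) * N h <= e / 2.
    have -> : e / 2 = e / (2 * c) * c by field; rewrite gt_eqF.
    by rewrite ler_wpM2l ?ltW// /c ltrDl.
  lra.
have /eqP := az h0; rewrite subr_eq0 => /eqP E1.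
have /eqP := az ('i *: h0); rewrite subr_eq0 fZ linearZl_LR /= => /eqP.
move: E1; case: (f h0) (inner h0 z) => [p q] [r s] /= -> .
rewrite !mul0r !mul1r !sub0r => /oppr_inj ->.
by [].
Qed.
End Riesz.
End Riesz.

Lemma adjointP (R : realType) (H : hilbertType R) (A : {linear H -> H}) :
  bounded_operator A -> forall x y, inner (A x) y = inner x (adjoint A y).
Proof.
move=> [M AM] x y; rewrite /adjoint.
case: xgetP => [z _ ->//|].
set M' := complex.Re `|M|.
have AM' w : complex.Re `|A w| <= M' * complex.Re `|w|.
  rewrite -lecR rmorphM /= /M' !RRe_real ?normr_real// (le_trans (AM w))//.
  rewrite -[leLHS]ger0_norm ?normrM ?normr_id//.
  by rewrite (le_trans (normr_ge0 _) (AM w)).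
have M'0 : 0 <= M' by rewrite -lecR RRe_real ?normr_real ?normr_ge0.
have [z zP] : exists z, forall h, inner (A h) y = inner h z.
  apply: (@Riesz.riesz_ex _ _ (fun h => inner (A h) y) _ _ (M' * complex.Re `|y|)).
  - by move=> u v; rewrite linearD linearDl.
  - by move=> c u; rewrite linearZ linearZl_LR.
  - move=> u; rewrite (le_trans (Riesz.CSReN _ _))// mulrAC ler_wpM2r ?Riesz.N0//.
by move/(_ z).
Qed.

(* Main.v *)
Require Import Defs.
From mathcomp Require Import sesquilinear complex lra.
From mathcomp Require Import all_boot all_order all_algebra.
From mathcomp Require Import all_classical all_reals all_analysis.
Import Order.TTheory GRing.Theory Num.Theory.
Set Implicit Arguments.
Unset Strict Implicit.
Local Open Scope ring_scope.

(* For a unit vector x,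
     |(A + D) x|^2 = |A x|^2 + |D x|^2 + 2 Re <D x, A x>,
   and one copy of |<D x, A x>| is bounded by |A||D|, the other, being equal to
   |<A^* D x, x>|, by w(A^* D).  The bound with w(A D^* ) is the same
   computation for A^* and D^*, transferred to A + D by duality. *)

Local Notation N x := (complex.Re `|x|).

Lemma normr_inner_le (R : realType) (H : hilbertType R) (u v : H) :
  N (inner u v) <= N u * N v.
Proof.
have [c0|c0] := eqVneq (inner u v) 0; first by rewrite c0 normr0 mulr_ge0 ?Riesz.N0.
(* Rotate u by a unimodular scalar so that its inner product with v is real. *)
pose w := (`|inner u v| / inner u v) *: u.
have -> : N u = N w.
  by rewrite /w normrZ normrM normr_id normfV mulfV ?normr_eq0// mul1r.
have -> : `|inner u v| = inner w v by rewrite /w linearZl_LR /= divfK.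
by apply: le_trans (Riesz.CSReN _ _); exact: ler_norm.
Qed.

Lemma Re_le_norm (R : realType) (c : R[i]) : complex.Re c <= N c.
Proof.
case: c => a b /=; apply: le_trans (ler_norm a) _.
by rewrite -sqrtr_sqr ler_wsqrtr// lerDl sqr_ge0.
Qed.

Lemma normR_scale (R : realType) (H : hilbertType R) (t : R) (x : H) :
  N (t%:C%C *: x) = `|t| * N x.
Proof.
have tE : `|t%:C%C| = `|t|%:C%C :> R[i].
  by rewrite normc_def /= expr0n addr0 sqrtr_sqr.
by rewrite normrZ tE Riesz.ReZ.
Qed.

Lemma normalizeP (R : realType) (H : hilbertType R) (x : H) : x != 0 ->
  exists e : H, `|e| = 1 /\ x = (N x)%:C%C *: e.
Proof.
move=> x0; have Nx0 : N x != 0.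
  by apply: contra x0 => /eqP E; rewrite -normr_eq0 Riesz.normcE E.
exists ((N x)^-1%:C%C *: x); split.
  by rewrite Riesz.normcE normR_scale ger0_norm ?invr_ge0 ?Riesz.N0// mulVf.
by rewrite scalerA -rmorphM /= mulfV// scale1r.
Qed.

Lemma opnorm_ub (R : realType) (H : hilbertType R) (B : H -> H) (x : H) :
  bounded_operator B -> `|x| <= 1 -> N (B x) <= opnorm B.
Proof.
move=> [M BM] x1; apply: ub_le_sup; last by exists x.
exists (N M) => _ [y /= y1 <-].
rewrite -lecR -Riesz.normcE -[leRHS]/(`|M|).
(* [M] is an arbitrary complex scalar, but [M * |y|] dominates a norm, hence is nonnegative and
   equals [|M| * |y|]. *)
have My : 0 <= M * `|y| by apply: le_trans (BM y).
apply: le_trans (BM y) _; rewrite -(ger0_norm My) normrM normr_id.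
by rewrite -[leRHS]mulr1 ler_wpM2l.
Qed.

Lemma opnorm_ge0 (R : realType) (H : hilbertType R) (B : H -> H) :
  bounded_operator B -> 0 <= opnorm B.
Proof.
move=> bB; apply: le_trans (opnorm_ub bB (x := 0) _); first exact: Riesz.N0.
by rewrite normr0.
Qed.

Lemma opnormP (R : realType) (H : hilbertType R) (B : {linear H -> H}) (x : H) :
  bounded_operator B -> N (B x) <= opnorm B * N x.
Proof.
move=> bB; have [->|/normalizeP[e [e1 xE]]] := eqVneq x 0.
  by rewrite linear0 !normr0 /= mulr0.
rewrite {1}xE linearZ /= normR_scale ger0_norm ?Riesz.N0// mulrC.
by rewrite ler_wpM2r ?Riesz.N0// opnorm_ub// e1.
Qed.

(** Scaling reduces the unit ball to the unit sphere. In the zero space the sphere is empty, and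
    [0 <= K] alone gives the bound. *)
Lemma opnorm_sqr_le (R : realType) (H : hilbertType R) (B : {linear H -> H})
    (K : R) : 0 <= K -> (forall e : H, `|e| = 1 -> N (B e) ^+ 2 <= K) ->
  opnorm B ^+ 2 <= K.
Proof.
move=> K0 BK; have ub : opnorm B <= Num.sqrt K.
  apply: ge_sup; first by exists (N (B 0)), 0 => //=; rewrite normr0.
  move=> _ [x /= x1 <-]; have [->|x0] := eqVneq x 0.
    by rewrite linear0 normr0 sqrtr_ge0.
  have [e [e1 xE]] := normalizeP x0.
  rewrite xE linearZ /= normR_scale ger0_norm ?Riesz.N0//.
  have le1 : N x <= 1 by move: x1; rewrite Riesz.normcE lecR.
  apply: le_trans (_ : N (B e) <= _); first by rewrite ler_piMl ?Riesz.N0.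
  by rewrite -(ger0_norm (Riesz.N0 (B e))) -sqrtr_sqr ler_wsqrtr// BK.
(* Squaring [ub] requires this sign; on a set without upper bound, [sup] takes its default value
   0. *)
have s0 : 0 <= opnorm B.
  have [[M ?]|nub] := pselect (has_ubound
      [set N (B x) | x in [set x : H | `|x| <= 1]]%classic).
    apply: le_trans (Riesz.N0 (B 0)) _; apply: ub_le_sup; first by exists M.
    by exists 0 => //=; rewrite normr0.
  by rewrite /opnorm sup_out// => -[].
by rewrite -[leRHS]sqr_sqrtr// lerXn2r ?nnegrE ?sqrtr_ge0.
Qed.

(** The constant [C] bounds the set from above, which makes its [sup] a genuine upper bound. *)
Lemma numradius_ub (R : realType) (H : hilbertType R) (B : H -> H) (C : R) (e : H) :
  (forall x, `|x| = 1 -> N (inner (B x) x) <= C) -> `|e| = 1 ->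
  N (inner (B e) e) <= numradius B.
Proof.
by move=> BC e1; apply: ub_le_sup; [exists C => _ [y /= /BC ? <-] | exists e].
Qed.

Lemma numradius_le (R : realType) (H : hilbertType R) (B : H -> H) (C : R) :
  0 <= C -> (forall x, `|x| = 1 -> N (inner (B x) x) <= C) ->
  numradius B <= C.
Proof.
move=> C0 BC; rewrite /numradius; set S := (X in sup X).
(* The zero space has no unit vector: there [sup set0 = 0], and [0 <= C] concludes. *)
have [->|/set0P S0] := eqVneq S set0; first by rewrite sup0.
by apply: ge_sup => // _ [x /= /BC ? <-].
Qed.

Lemma numradius_ge0 (R : realType) (H : hilbertType R) (B : H -> H) :
  0 <= numradius B.
Proof.
rewrite /numradius; set S := (X in sup X).
have [[[r [x x1 rE]] Sub]|nS] := pselect (has_sup S); last by rewrite sup_out.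
apply: le_trans (_ : r <= _); last by apply: ub_le_sup => //; exists x.
by rewrite -rE; case: (inner (B x) x) => p q; exact: sqrtr_ge0.
Qed.

Lemma norm_innerC (R : realType) (H : hilbertType R) (x y : H) :
  N (inner x y) = N (inner y x).
Proof. by rewrite Riesz.innerC; case: (inner y x) => a b /=; rewrite sqrrN. Qed.

(** |B^* y|^2 = Re <B B^* y, y> is at most |B| |B^* y| |y|; then one factor |B^* y| cancels. *)
Lemma norm_adjoint_le (R : realType) (H : hilbertType R) (B : {linear H -> H})
    (y : H) : bounded_operator B -> N (adjoint B y) <= opnorm B * N y.
Proof.
move=> bB; have [E|n0] := eqVneq (N (adjoint B y)) 0.
  by rewrite E mulr_ge0 ?opnorm_ge0 ?Riesz.N0.
have p0 : 0 < N (adjoint B y) by rewrite lt_def n0 Riesz.N0.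
rewrite -(ler_pM2r p0) -expr2.
have -> : N (adjoint B y) ^+ 2 = complex.Re (inner (B (adjoint B y)) y).
  by rewrite (adjointP bB) Riesz.innerxx.
apply: le_trans (Re_le_norm _) (le_trans (normr_inner_le _ _) _).
by rewrite mulrAC ler_wpM2r ?Riesz.N0// opnormP.
Qed.

(** The computation shared by both bounds: it serves for [A e], [D e] and again for [adjoint A e],
    [adjoint D e]. *)
Lemma norm_sqrD_le (R : realType) (H : hilbertType R) (p q : H) (a d w : R) :
  N p <= a -> N q <= d -> N (inner q p) <= w ->
  N (p + q) ^+ 2 <= a ^+ 2 + d ^+ 2 + a * d + w.
Proof.
move=> pa qd ww; have := Riesz.NDZ p 1 q; rewrite rmorph1 scale1r => ->.
have p0 := Riesz.N0 p; have q0 := Riesz.N0 q.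
have r1 := Re_le_norm (inner q p); have r2 := normr_inner_le q p.
have : N q * N p <= d * a by rewrite ler_pM.
have : N p ^+ 2 <= a ^+ 2 by rewrite lerXn2r ?nnegrE// (le_trans p0).
have : N q ^+ 2 <= d ^+ 2 by rewrite lerXn2r ?nnegrE// (le_trans q0).
rewrite expr1n; lra.
Qed.

Theorem theorem2p7 (R : realType) (H : hilbertType R) (A D : {linear H -> H})
    (bA : bounded_operator A) (bD : bounded_operator D) :
  opnorm (A \+ D) ^+ 2
    <= opnorm A ^+ 2 + opnorm D ^+ 2 + opnorm A * opnorm D
       + Num.min (numradius (adjoint A \o D)) (numradius (A \o adjoint D))
    <= (opnorm A + opnorm D) ^+ 2.
Proof.
have a0 := opnorm_ge0 bA; have d0 := opnorm_ge0 bD.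
have innerA e : N (inner ((adjoint A \o D) e) e) = N (inner (D e) (A e)).
  (* [adjointP] moves an operator out of the first argument, so the arguments are swapped before and
     after; the modulus is unaffected. *)
  by rewrite norm_innerC -[in LHS]/(adjoint A (D e)) -(adjointP bA) norm_innerC.
have w1ub e : `|e| = 1 ->
    N (inner ((adjoint A \o D) e) e) <= opnorm A * opnorm D.
  move=> e1; rewrite innerA (le_trans (normr_inner_le _ _))// mulrC.
  by rewrite ler_pM ?Riesz.N0// opnorm_ub// e1.
have adj_ub (B : {linear H -> H}) (e : H) : bounded_operator B -> `|e| = 1 ->
    N (adjoint B e) <= opnorm B.
  by move=> bB e1; have := norm_adjoint_le e bB; rewrite e1 /= mulr1.
have w2ub e : `|e| = 1 ->
    N (inner ((A \o adjoint D) e) e) <= opnorm A * opnorm D.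
  move=> e1; rewrite -[(A \o _) e]/(A (adjoint D e)) (adjointP bA).
  rewrite (le_trans (normr_inner_le _ _))// mulrC.
  by rewrite ler_pM ?Riesz.N0// adj_ub.
apply/andP; split; last first.
  (* The minimum is at most its first entry, hence at most |A||D|, which completes the square. *)
  have := numradius_le (mulr_ge0 a0 d0) w1ub.
  have : Num.min (numradius (adjoint A \o D)) (numradius (A \o adjoint D))
    <= numradius (adjoint A \o D) by rewrite ge_min lexx.
  set m := Num.min _ _; set w := numradius _; rewrite sqrrD; lra.
(* The minimum is one of its two entries, and the bound is proved with each of them. *)
rewrite minEle; case: ifP => _; apply: opnorm_sqr_le.
- by rewrite !addr_ge0 ?sqr_ge0 ?mulr_ge0 ?numradius_ge0.
- move=> e e1; apply: norm_sqrD_le; rewrite ?opnorm_ub ?e1//.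
  by rewrite -innerA; apply: numradius_ub w1ub e1.
- by rewrite !addr_ge0 ?sqr_ge0 ?mulr_ge0 ?numradius_ge0.
move=> x x1; rewrite -[X in N X]/(A x + D x).
have [E|y0] := eqVneq (A x + D x) 0.
  by rewrite E normr0 expr0n !addr_ge0 ?sqr_ge0 ?mulr_ge0 ?numradius_ge0.
have [e [e1 yE]] := normalizeP y0.
(* With [e] the direction of (A + D) x, the norm of (A + D) x is <(A + D) x, e> = <x, A^* e + D^*
   e>, and Cauchy-Schwarz applies since |x| = 1. *)
have dual : N (A x + D x) <= N (adjoint A e + adjoint D e).
  have yeE : inner (A x + D x) e = (N (A x + D x))%:C%C.
    by rewrite {1}yE (linearZl_LR inner) /= inner_normE e1 expr1n; exact: mulr1.
  have adjE : inner (A x + D x) e = inner x (adjoint A e + adjoint D e).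
    by rewrite (linearDl inner) (linearDr inner) /= !adjointP.
  have -> : N (A x + D x) = complex.Re (inner x (adjoint A e + adjoint D e)).
    by rewrite -adjE yeE.
  apply: le_trans (Re_le_norm _) (le_trans (normr_inner_le _ _) _).
  by rewrite x1 mul1r.
apply: le_trans (_ : N (adjoint A e + adjoint D e) ^+ 2 <= _).
  by rewrite lerXn2r ?nnegrE ?Riesz.N0.
apply: norm_sqrD_le; rewrite ?adj_ub//.
by rewrite -(adjointP bA); apply: numradius_ub w2ub e1.
Qed.
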